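(* Let $\mathcal{L}$ be an infinite-dimensional Lie algebra. (i) If $\mathcal{L}$ is pro-nilpotent, then the family of operators $\operatorname{ad}(\mathcal{L})$ is strictly triangularizable. (ii) If for an element $x\in\mathcal{L}$ the operator $\operatorname{ad}_x$ is pro-nilpotent, then $\operatorname{ad}_x$ is strictly triangularizable.
   Context: All Lie algebras and vector spaces are over $\mathbb{C}$ and have a countable Hamel basis. For a Lie algebra $\mathcal{L}$ put $\mathcal{L}^1=\mathcal{L}$, $\mathcal{L}^{k+1}=[\mathcal{L}^k,\mathcal{L}]$. An infinite-dimensional Lie algebra $\mathcal{L}$ is pro-nilpotent if $\bigcap_{i\ge1}\mathcal{L}^i=0$ and $\dim(\mathcal{L}/\mathcal{L}^{i+1})<\infty$ for all $i\ge1$. A linear transformation $T$ of a vector space $V$ is triangularizable if there is a chain of $T$-invariant subspaces $V=\mathcal{V}_1\supset\mathcal{V}_2\supset\cdots\supset\mathcal{V}_i\supset\mathcal{V}_{i+1}\supset\cdots\supset\{0\}$ with $\dim(\mathcal{V}_i/\mathcal{V}_{i+1})=1$ and $\bigcap_i\mathcal{V}_i=\{0\}$; it is strictly triangularizable if moreover the chain can be chosen with $T(\mathcal{V}_i)\subseteq\mathcal{V}_{i+1}$ for all $i$. $T$ is called pro-nilpotent if $\bigcap_{i\ge1}\operatorname{Im}(T^i)=\{0\}$ and $\dim(T^i(V)/T^{i+1}(V))<\infty$ for all $i\ge0$, where $T^0(V)=V$. The family $\operatorname{ad}(\mathcal{L})$ is strictly triangularizable if there is a chain of ideals $\mathcal{L}=\mathcal{V}_1\supset\mathcal{V}_2\supset\cdots\supset\{0\}$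 with $\dim(\mathcal{V}_i/\mathcal{V}_{i+1})=1$, $\bigcap_i\mathcal{V}_i=\{0\}$ and $\operatorname{ad}(\mathcal{L})(\mathcal{V}_i)\subseteq\mathcal{V}_{i+1}$ for all $i$. *)

(* Defs.v *)
From HB Require Import structures.
From mathcomp Require Import all_boot all_order all_algebra.
From mathcomp Require Import mathcomp_extra boolp classical_sets functions.
From mathcomp Require Import cardinality reals.
From mathcomp Require Export complex.

Set Implicit Arguments.
Unset Strict Implicit.
Unset Printing Implicit Defensive.

Import GRing.Theory.
Local Open Scope classical_set_scope.
Local Open Scope ring_scope.

Section VectorSpaces.
Variables (K : fieldType) (V : lmodType K).
Implicit Types (U W A B : set V) (F : nat -> set V).

Definition linear_subspace (U : set V) : Prop := submod_closed (mem U).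

Definition lin_span A : set V :=
  [set v | exists2 s : seq V, {in s, forall a, A a} &
           exists c : V -> K, v = \sum_(a <- s) c a *: a].

(* B is a set of representatives of a basis of U / W, for W contained in U:
   members of U that span U modulo W and are linearly independent modulo W
   (in particular they lie in pairwise distinct cosets of W). *)
Definition quot_basis U W B : Prop :=
  [/\ B `<=` U,
      forall u, U u -> exists2 v, lin_span B v & W (u - v)
    & forall (s : seq V) (c : V -> K),
        uniq s -> {in s, forall b, B b} -> W (\sum_(b <- s) c b *: b) ->
        {in s, forall b, c b = 0}].

Definition quot_dim U W (n : nat) : Prop :=
  exists2 B, quot_basis U W B & (B #= `I_n)%card.

Definition quot_fin_dim U W : Prop := exists n, quot_dim U W n.

Definition hamel_basis B : Prop := quot_basis setT [set 0] B.

Definition has_countable_basis : Prop :=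
  exists2 B, hamel_basis B & countable B.

Definition infinite_dim : Prop := ~ quot_fin_dim setT [set 0].

(* F i is the subspace usually written V_(i+1): chains start at V_1. Such an
   infinite chain with one-dimensional quotients forces V to be
   infinite-dimensional. *)
Definition full_chain F : Prop :=
  [/\ F 0%N = setT,
      forall i, linear_subspace (F i),
      forall i, F i.+1 `<=` F i,
      forall i, quot_dim (F i) (F i.+1) 1
    & \bigcap_i F i = [set 0]].

Definition triangularizing_chain (T : {linear V -> V}) F : Prop :=
  full_chain F /\ forall i, T @` F i `<=` F i.

Definition triangularizable (T : {linear V -> V}) : Prop :=
  exists F, triangularizing_chain T F.

Definition strictly_triangularizable (T : {linear V -> V}) : Prop :=
  exists2 F, triangularizing_chain T F & forall i, T @` F i `<=` F i.+1.

Definition pro_nilpotent_op (T : {linear V -> V}) : Prop :=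
  \bigcap_(i in [set i | (1 <= i)%N]) range (iter i T) = [set 0] /\
  forall i, quot_fin_dim (range (iter i T)) (range (iter i.+1 T)).

End VectorSpaces.

Arguments has_countable_basis {K} V.
Arguments infinite_dim {K} V.

HB.mixin Record Lmodule_isLieAlgebra (K : fieldType) L of GRing.Lmodule K L := {
  lie_bracket : L -> L -> L;
  lie_bracket_linearl : forall y, linear (lie_bracket ^~ y);
  lie_bracket_linearr : forall x, linear (lie_bracket x);
  lie_bracketxx : forall x, lie_bracket x x = 0;
  lie_jacobi : forall x y z,
    lie_bracket x (lie_bracket y z) + lie_bracket y (lie_bracket z x)
      + lie_bracket z (lie_bracket x y) = 0
}.

#[short(type="lieAlgebraType")]
HB.structure Definition LieAlgebra (K : fieldType) :=
  {L of GRing.Lmodule K L & Lmodule_isLieAlgebra K L}.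

Section LieAlgebras.
Variables (K : fieldType) (L : lieAlgebraType K).

Definition ad (x : L) : L -> L := lie_bracket x.

HB.instance Definition _ (x : L) :=
  GRing.isLinear.Build K L L *:%R (ad x) (lie_bracket_linearr x).

Definition bracket_span (A B : set L) : set L :=
  lin_span [set z | exists x y, [/\ A x, B y & z = lie_bracket x y]].

(* lower_central k is L^(k+1): the series starts at L^1 = L. *)
Fixpoint lower_central (k : nat) : set L :=
  if k is k'.+1 then bracket_span (lower_central k') setT else setT.

(* The last clause is dim (L / L^(i+1)) < oo for i >= 1. *)
Definition pro_nilpotent_lie : Prop :=
  [/\ infinite_dim L,
      \bigcap_k lower_central k = [set 0]
    & forall i, (1 <= i)%N -> quot_fin_dim setT (lower_central i)].

Definition lie_ideal (I : set L) : Prop :=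
  linear_subspace I /\ forall x y, I y -> I (lie_bracket x y).

Definition ad_strictly_triangularizable : Prop :=
  exists F : nat -> set L,
    [/\ full_chain F,
        forall i, lie_ideal (F i)
      & forall (x : L) i, ad x @` F i `<=` F i.+1].

End LieAlgebras.

Arguments pro_nilpotent_lie {K} L.
Arguments ad_strictly_triangularizable {K} L.

(* Main.v *)
Require Import Defs.
From mathcomp Require Import all_boot all_order all_algebra.
From mathcomp Require Import reals complex.
From mathcomp Require Import boolp classical_sets functions cardinality.

(** Both parts have the same source: a decreasing sequence of subspaces
    G 0 = V, G 1, G 2, ... with finite-dimensional quotients and zero
    intersection, together with operators mapping each G k into G (k + 1). In
    (i) it is the lower central series, the operators being all ad x; in (ii)
    it is the sequence of the images of the powers of ad x.

    Such a sequence refines to a full chain F in which every step from F i to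
    F (i + 1) happens inside a single layer, that is, F i is contained in G k
    and F (i + 1) contains G (k + 1) for some k ([refining_chain]). An operator
    mapping G k into G (k + 1) then maps F i into F (i + 1), which is all that
    strict triangularizability asks of it. For ad this also makes every F i an
    ideal.

    To refine, take in each G k a list of vectors that is a basis of G k modulo
    G (k + 1) ([free_generators]), and concatenate the lists of the first k
    layers into a list S k, which is a basis of V modulo G k. As k grows these
    lists extend one another, and F i is spanned modulo G k by S k without its
    first i entries, for any k such that S k has at least i entries. Removing
    one more entry lowers the dimension by one. The lists S k grow without
    bound: otherwise the sequence G would be constant from some point on, hence
    zero there since its intersection is zero, and V would have finite
    dimension. *)

Set Implicit Arguments.
Unset Strict Implicit.
Unset Printing Implicit Defensive.

Import GRing.Theory.
Local Open Scope classical_set_scope.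
Local Open Scope ring_scope.

(** * Subspaces and lists of vectors modulo a subspace *)

Section Subspaces.
Variables (K : fieldType) (V : lmodType K).
Implicit Types (U W A B : set V) (s t : seq V).

Lemma linear_subspaceP U :
  linear_subspace U <->
  U 0 /\ forall c u v, U u -> U v -> U (c *: u + v).
Proof.
split=> [[U0 Ulin]|[U0 Ulin]]; split.
- by move: U0; rewrite inE.
- move=> c u v Uu Uv.
  by have /set_mem := Ulin c u v (mem_set Uu) (mem_set Uv).
- exact: mem_set.
- by move=> c u v /set_mem Uu /set_mem Uv; apply: mem_set; apply: Ulin.
Qed.

Section Closure.
Variable U : set V.
Hypothesis Usub : linear_subspace U.

Lemma subspace0 : U 0.
Proof. by case/linear_subspaceP: Usub. Qed.

Lemma subspaceD u v : U u -> U v -> U (u + v).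
Proof.
by case/linear_subspaceP: Usub => _ Ul Uu Uv; rewrite -[u]scale1r; apply: Ul.
Qed.

Lemma subspaceZ c u : U u -> U (c *: u).
Proof.
case/linear_subspaceP: Usub => U0 Ul Uu.
by rewrite -[_ *: _]addr0; apply: Ul.
Qed.

Lemma subspaceN u : U u -> U (- u).
Proof. by move=> Uu; rewrite -scaleN1r; apply: subspaceZ. Qed.

Lemma subspaceB u v : U u -> U v -> U (u - v).
Proof. by move=> Uu Uv; apply: subspaceD => //; apply: subspaceN. Qed.

Lemma subspace_sum s (c : V -> K) :
  {in s, forall a, U a} -> U (\sum_(a <- s) c a *: a).
Proof.
move=> sU; rewrite big_seq; elim/big_ind: _ => [|x y|a /sU]; first exact: subspace0.
- exact: subspaceD.
- exact: subspaceZ.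
Qed.

Lemma lin_span_subset A : A `<=` U -> lin_span A `<=` U.
Proof.
by move=> AU _ [s sA [c ->]]; apply: subspace_sum => a /sA /AU.
Qed.

End Closure.

Lemma sub_lin_span A a : A a -> lin_span A a.
Proof.
move=> Aa; exists [:: a] => [x|]; first by rewrite inE => /eqP ->.
by exists (fun=> 1); rewrite big_seq1 scale1r.
Qed.

Lemma lin_spanS A B : A `<=` B -> lin_span A `<=` lin_span B.
Proof. by move=> AB v [s sA vE]; exists s => // a /sA /AB. Qed.

(** Rewriting a linear combination over a duplicate-free list containing its
    support lets two combinations over different lists be added, and so
    shows that linear spans are subspaces. *)
Lemma sum_count s r (c : V -> K) :
    uniq r -> {subset s <= r} ->
  \sum_(a <- s) c a *: a = \sum_(a <- r) (c a *+ count_mem a s) *: a.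
Proof.
move=> ur; elim: s => [|x s IHs] sr /=.
  by rewrite big_nil big1 // => a _; rewrite mulr0n scale0r.
rewrite big_cons IHs; last by move=> a sa; apply: sr; rewrite inE sa orbT.
under [RHS]eq_bigr do rewrite mulrnDr scalerDl.
rewrite big_split /=; congr (_ + _).
have xr : x \in r by apply: sr; rewrite mem_head.
rewrite (bigD1_seq x) //= eqxx mulr1n big1 ?addr0 // => a ax.
by rewrite eq_sym (negbTE ax) mulr0n scale0r.
Qed.

Lemma lin_span_subspace A : linear_subspace (lin_span A).
Proof.
apply/linear_subspaceP; split.
  by exists [::] => //; exists (fun=> 0); rewrite big_nil.
move=> k _ _ [s sA [c ->]] [t tA [d ->]].
exists (undup (s ++ t)) => [a|].
  by rewrite mem_undup mem_cat => /orP[/sA|/tA].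
have st x : x \in s -> x \in undup (s ++ t).
  by rewrite mem_undup mem_cat => ->.
have ts x : x \in t -> x \in undup (s ++ t).
  by rewrite mem_undup mem_cat orbC => ->.
exists (fun a => k * (c a *+ count_mem a s) + d a *+ count_mem a t).
rewrite (sum_count c (undup_uniq _) st) (sum_count d (undup_uniq _) ts).
rewrite scaler_sumr -big_split /=; apply: eq_bigr => a _.
by rewrite scalerDl scalerA.
Qed.

(** The subspace U + Ka. Adding one line at a time makes the inductions on
    lists below free of coefficient families. *)
Definition add_line (a : V) U : set V := [set v | exists c : K, U (v - c *: a)].

Definition span_over W s : set V := foldr add_line W s.

(** Each vector lies outside the span, modulo W, of the vectors after it, which
    amounts to linear independence modulo W. This triangular form says that
    each entry of the list accounts for exactly one dimension. *)
Fixpoint free_over W s : Prop :=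
  if s is a :: s' then ~ span_over W s' a /\ free_over W s' else True.

Lemma add_line_subspace a U :
  linear_subspace U -> linear_subspace (add_line a U).
Proof.
move=> Us; apply/linear_subspaceP; split.
  by exists 0; rewrite scale0r subr0; apply: subspace0.
move=> c u v [x Ux] [y Uy]; exists (c * x + y).
rewrite scalerDl opprD addrACA -scalerA -scalerBr.
by apply: subspaceD => //; apply: subspaceZ.
Qed.

Lemma sub_add_line a U : U `<=` add_line a U.
Proof. by move=> u Uu; exists 0; rewrite scale0r subr0. Qed.

Lemma mem_add_line a U : linear_subspace U -> add_line a U a.
Proof. by exists 1; rewrite scale1r subrr; apply: subspace0. Qed.

Lemma span_over_subspace W s :
  linear_subspace W -> linear_subspace (span_over W s).
Proof. by move=> Ws; elim: s => //= a s; apply: add_line_subspace. Qed.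

Lemma sub_span_over W s : W `<=` span_over W s.
Proof.
by elim: s => //= a s /subset_trans; apply; apply: sub_add_line.
Qed.

Lemma mem_span_over W s :
  linear_subspace W -> {in s, forall a, span_over W s a}.
Proof.
move=> Ws; elim: s => //= b s IHs a; rewrite inE => /predU1P[->|/IHs].
  exact/mem_add_line/span_over_subspace.
exact: sub_add_line.
Qed.

Lemma span_over_cat W s t : span_over W (s ++ t) = span_over (span_over W t) s.
Proof. exact: foldr_cat. Qed.

Lemma free_over_cat W s t :
  free_over (span_over W t) s -> free_over W t -> free_over W (s ++ t).
Proof.
by elim: s => //= a s IHs [aNs fs] ft; rewrite span_over_cat; split=> //; apply: IHs.
Qed.

Lemma free_over_drop W s i : free_over W s -> free_over W (drop i s).
Proof. by elim: s i => //= a s IHs [|i] //= [_ /IHs]. Qed.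

Lemma quot_dim0 U : linear_subspace U -> quot_dim U U 0.
Proof.
move=> Us; exists set0; last by rewrite II0.
split=> [//|u Uu|s c _ s0 _ a /s0 //].
exists 0; last by rewrite subr0.
by exists [::] => //; exists (fun=> 0); rewrite big_nil.
Qed.

(** A basis B of U modulo W is completed by a: in a relation modulo W between a
    and vectors of B, a nonzero coefficient at a would put a in U. *)
Lemma quot_dim_add_line U W a n :
    linear_subspace U -> W `<=` U -> ~ U a ->
  quot_dim U W n -> quot_dim (add_line a U) W n.+1.
Proof.
move=> Us WU aNU [B [BU Bgen Bfree] Bn].
have aNB : ~ B a by move=> /BU.
exists (a |` B); last first.
  apply/eq_cardSP; exists a; first by left.
  by rewrite setUKD // => x [->].
split.
- move=> x [->|/BU]; first exact: mem_add_line.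
  exact: sub_add_line.
- move=> u [k /Bgen[_ [s sB [c ->]]]] Wuv.
  have aNs : a \notin s by apply/negP => /sB.
  exists (\sum_(x <- a :: s) (if x == a then k else c x) *: x).
    exists (a :: s); last by exists (fun x => if x == a then k else c x).
    by move=> x; rewrite inE => /predU1P[->|/sB]; [left|right].
  rewrite big_cons eqxx big_seq; under eq_bigr => x xs.
    rewrite ifN; last by apply: contraNneq aNs => <-.
    over.
  by rewrite -big_seq opprD addrA.
- move=> s c us sB Wsum.
  have sB' : {in rem a s, forall x, B x}.
    by move=> x; rewrite mem_rem_uniq // inE => /andP[/eqP xa /sB[]].
  have [as_|aNs] := boolP (a \in s); last first.
    apply: Bfree => // x xs; case: (sB x xs) => // xa.
    by rewrite -xa xs in aNs.
  move: Wsum; rewrite (perm_big _ (perm_to_rem as_)) big_cons /= => Wsum.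
  have ca0 : c a = 0.
    apply: contrapT => /eqP ca0; apply: aNU.
    rewrite -[a]scale1r -(mulVf ca0) -scalerA; apply: subspaceZ => //.
    rewrite -[_ *: a](addrK (\sum_(x <- rem a s) c x *: x)).
    apply: subspaceB => //; first exact: WU.
    by apply: subspace_sum => // x /sB' /BU.
  move: Wsum; rewrite ca0 scale0r /= add0r => Wsum x xs.
  have [->//|xa] := eqVneq x a.
  apply: (Bfree (rem a s)) => //; first exact: rem_uniq.
  by rewrite mem_rem_uniq // inE xa.
Qed.

Lemma quot_dim_span_over W s :
  linear_subspace W -> free_over W s -> quot_dim (span_over W s) W (size s).
Proof.
move=> Ws; elim: s => [_|a s IHs [aNs /IHs dims]] /=; first exact: quot_dim0.
apply: quot_dim_add_line => //; first exact: span_over_subspace.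
exact: sub_span_over.
Qed.

Lemma quot_fin_dim_span_over U W :
    linear_subspace W -> quot_fin_dim U W ->
  exists s, U `<=` span_over W s.
Proof.
move=> Ws [n [B [_ Bgen _] Bn]].
have /finite_seqP[s BE] : finite_set B by exists n.
exists s => u /Bgen[v vB Wuv]; rewrite -[u](subrK v).
have Ss := span_over_subspace s Ws.
apply: subspaceD => //; first exact: sub_span_over.
by apply: (lin_span_subset Ss _ vB) => a; rewrite BE; apply: mem_span_over.
Qed.

(** The generators in s need not lie in U, so a basis cannot be extracted from
    them. By induction on s, the part of U spanned modulo W without the first
    generator a has a free list of generators; if that part is not all of U,
    any vector u of U outside it has a nonzero coefficient at a, and eliminating
    a by means of u shows that u generates the rest of U. *)
Lemma free_generators U W s :
    linear_subspace U -> linear_subspace W -> W `<=` U ->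
    U `<=` span_over W s ->
  exists2 t, U = span_over W t & free_over W t.
Proof.
move=> + Ws; elim: s U => [|a s IHs] U Us WU UWs.
  by exists [::] => //; apply/seteqP; split.
have Ss := span_over_subspace s Ws.
have [Usub|] := pselect (U `<=` span_over W s); first exact: IHs.
move=> /existsNP[u /not_implyP[Uu uNs]].
have [|||t U'E ft] := IHs (U `&` span_over W s).
- apply/linear_subspaceP; split; first by split; apply: subspace0.
  by move=> c x y [Ux sx] [Uy sy]; split; apply: subspaceD => //; apply: subspaceZ.
- by move=> w Ww; split; [apply: WU | apply: sub_span_over].
- by move=> w [].
exists (u :: t); last by split=> //; rewrite -U'E => -[].
rewrite /= -/(span_over W t) -U'E; apply/seteqP; split=> [v Uv|v [c [Uvu _]]]; last first.
  by rewrite -[v](subrK (c *: u)); apply: subspaceD => //; apply: subspaceZ.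
have [k sv] := UWs v Uv; have [k0 su] := UWs u Uu.
have k0N0 : k0 != 0.
  by apply: contra_notN uNs => /eqP k00; move: su; rewrite k00 scale0r subr0.
exists (k / k0); split.
  by apply: subspaceB => //; apply: subspaceZ.
have -> : v - (k / k0) *: u = (v - k *: a) - (k / k0) *: (u - k0 *: a).
  by rewrite scalerBr scalerA divfK // opprB addrA subrK.
by apply: subspaceB => //; apply: subspaceZ.
Qed.

End Subspaces.

(** * Refining a filtration to a full chain *)

Section Refinement.
Variables (K : fieldType) (V : lmodType K) (G : nat -> set V).
Hypotheses (Vinf : infinite_dim V) (G0 : G 0 = setT).
Hypotheses (Gsub : forall k, linear_subspace (G k)).
Hypotheses (Gdecr : forall k, G k.+1 `<=` G k).
Hypotheses (Gfin : forall k, exists s, G k `<=` span_over (G k.+1) s).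
Hypothesis Gcap : \bigcap_k G k = [set 0].

(** The second conclusion is what transfers strict lowering along G to strict
    lowering along F. *)
Lemma refining_chain :
  exists2 F, full_chain F &
    forall i, exists2 k, F i `<=` G k & G k.+1 `<=` F i.+1.
Proof.
have /choice[s sP] : forall k, exists s,
    G k = span_over (G k.+1) s /\ free_over (G k.+1) s.
  move=> k; have [s Gs] := Gfin k.
  by have [t ? ?] := free_generators (Gsub k) (Gsub k.+1) (@Gdecr k) Gs; exists t.
pose S := fix S k := if k is k'.+1 then S k' ++ s k' else [::].
have GS k : G 0 = span_over (G k) (S k) /\ free_over (G k) (S k).
  elim: k => [//|k [GSk fSk]] /=; have [Gk fk] := sP k.
  rewrite span_over_cat -Gk; split=> //.
  by apply: free_over_cat; rewrite -?Gk.
(* For fixed i this set stops depending on k once S k has i entries, because the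
   entries added later span exactly the layers between the two values of k. *)
pose Fk i k := span_over (G k) (drop i (S k)).
have Fk_stable i k n : (i <= size (S k))%N -> Fk i (n + k)%N = Fk i k.
  move=> ik; have ink m : (i <= size (S (m + k)))%N.
    by elim: m => //= m /leq_trans; apply; rewrite size_cat leq_addr.
  elim: n => //= n <-; rewrite /Fk /= drop_cat.
  have [_|] := ltnP; first by rewrite span_over_cat -(sP _).1.
  rewrite leq_eqVlt ltnNge ink orbF => /eqP iE.
  by rewrite -iE subnn drop0 drop_size /= -(sP _).1.
have Sunbounded N : exists k, (N <= size (S k))%N.
  apply: contrapT => /forallNP Sbd.
  (* A longest S k0 exists, no vectors are added after it, and G is constant
     from k0 on. *)
  have [k0 k0max] : exists k0, forall k, (size (S k) <= size (S k0))%N.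
    have exS : exists m, `[< exists k, size (S k) = m >].
      by exists (size (S 0%N)); apply/asboolP; exists 0%N.
    have bdS m : `[< exists k, size (S k) = m >] -> (m <= N)%N.
      by move=> /asboolP[k <-]; rewrite leqNgt; apply/negP => /ltnW /Sbd.
    case: (ex_maxnP exS bdS) => _ /asboolP[k0 <-] k0max.
    by exists k0 => k; apply: k0max; apply/asboolP; exists k.
  have Gk0 n : G (n + k0)%N = G k0.
    have := Fk_stable _ _ n (leqnn (size (S k0))).
    by rewrite /Fk drop_size drop_oversize.
  have Gle n k : G (k + n)%N `<=` G k.
    elim: n => [|n IHn]; first by rewrite addn0.
    by rewrite addnS; apply: subset_trans IHn.
  have Gk00 : G k0 = [set 0].
    apply/seteqP; split=> [v Gv|_ ->]; last exact: subspace0.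
    by rewrite -Gcap => k _; apply: (Gle k0); rewrite Gk0.
  apply: Vinf; exists (size (S k0)).
  have [Sk0 fk0] := GS k0.
  by rewrite -Gk00 -G0 Sk0; apply: quot_dim_span_over.
pose F i : set V := [set v | exists2 k, (i <= size (S k))%N & Fk i k v].
have FE i k : (i <= size (S k))%N -> F i = Fk i k.
  move=> ik; apply/seteqP; split=> [v [l il]|v]; last by exists k.
  by rewrite -(Fk_stable _ _ k il) addnC Fk_stable.
have FG k : F (size (S k)) = G k by rewrite (FE _ k) // /Fk drop_size.
have Fstep i : exists2 a, F i = add_line a (F i.+1) & ~ F i.+1 a.
  have [k ik] := Sunbounded i.+1.
  rewrite (FE _ _ (ltnW ik)) (FE _ _ ik) /Fk (drop_nth 0 ik).
  exists (S k)`_i => //.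
  have := free_over_drop i (GS k).2.
  by rewrite (drop_nth 0 ik) => -[].
have Fsub i : linear_subspace (F i).
  by have [k ik] := Sunbounded i; rewrite (FE _ _ ik); apply: span_over_subspace.
have FS i : F i.+1 `<=` F i by have [a -> _] := Fstep i; apply: sub_add_line.
have Fdecr i j : (i <= j)%N -> F j `<=` F i.
  move=> /subnK <-; elim: (j - i)%N => [//|n IHn].
  exact: subset_trans (FS _) IHn.
exists F.
  split=> //.
  - by rewrite -G0 -(FG 0%N).
  - move=> i; have [a -> aN] := Fstep i.
    by apply: quot_dim_add_line => //; apply: quot_dim0.
  - apply/seteqP; split=> [v Fv|_ -> i _]; last exact: subspace0.
    by rewrite -Gcap => k _; rewrite -FG; apply: Fv.
(* Taking k + 1 minimal with S (k + 1) longer than i gives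
   size (S k) <= i < size (S (k + 1)), and F (size (S k)) is G k. *)
move=> i; have kP : exists k, (i < size (S k))%N by apply: Sunbounded.
case: (ex_minnP kP) => -[//|k] ik kmin.
exists k; last by rewrite -FG; apply: Fdecr.
rewrite -FG; apply: Fdecr; rewrite leqNgt; apply/negP => /kmin.
by rewrite ltnn.
Qed.

End Refinement.

(** * The lower central series *)

Section LowerCentral.
Variables (K : fieldType) (L : lieAlgebraType K).

Lemma lower_central_subspace k : linear_subspace (@lower_central K L k).
Proof.
case: k => [|k]; last exact: lin_span_subspace.
exact/linear_subspaceP.
Qed.

Lemma lower_centralS k : @lower_central K L k.+1 `<=` @lower_central K L k.
Proof.
elim: k => [//|k IHk]; apply: lin_spanS => _ [x [y [Lx _ ->]]].
by exists x, y; split=> //; apply: IHk.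
Qed.

Lemma lie_bracket_antisym (x y : L) : lie_bracket x y = lie_bracket (- y) x.
Proof.
have addl u v w : lie_bracket (u + v) w = lie_bracket u w + lie_bracket v w :> L.
  by have := lie_bracket_linearl w 1 u v; rewrite !scale1r.
have addr u v w : lie_bracket w (u + v) = lie_bracket w u + lie_bracket w v :> L.
  by have := lie_bracket_linearr w 1 u v; rewrite !scale1r.
have lie0 : lie_bracket 0 x = 0 :> L.
  by have := lie_bracket_linearl x (-1) x x; rewrite !scaleN1r !addNr.
have oppl : lie_bracket (- y) x = - lie_bracket y x.
  by apply/eqP; rewrite -addr_eq0 -addl addNr lie0.
have := lie_bracketxx (x + y); rewrite addr !addl !lie_bracketxx add0r addr0.
by rewrite oppl => /eqP; rewrite addrC addr_eq0 => /eqP.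
Qed.

(** The lower central series brackets with L on the right, whereas ad x brackets
    on the left; antisymmetry moves the sign onto the element of the series. *)
Lemma ad_lower_central (x : L) k :
  ad x @` lower_central k `<=` lower_central k.+1.
Proof.
move=> _ [y Ly <-]; apply: sub_lin_span; exists (- y), x; split=> //.
- by apply: subspaceN => //; apply: lower_central_subspace.
- exact: lie_bracket_antisym.
Qed.

Lemma pro_nilpotent_lie_ad :
  pro_nilpotent_lie L -> ad_strictly_triangularizable L.
Proof.
move=> [Linf capL finL].
have [||k||F Ffull Fk] := @refining_chain K L (@lower_central K L) Linf erefl.
- exact: lower_central_subspace.
- exact: lower_centralS.
- have [s Ls] := quot_fin_dim_span_over (lower_central_subspace k.+1) (finL k.+1 isT).
  by exists s => v _; apply: Ls.
- exact: capL.
have [_ Fsub Fdecr _ _] := Ffull.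
have adF x i : ad x @` F i `<=` F i.+1.
  have [k FG GF] := Fk i; apply: subset_trans GF.
  by apply: subset_trans (@ad_lower_central x k); apply: image_subset.
exists F; split=> // i; split=> // x y Fy.
by apply: Fdecr; apply: (adF x); exists y.
Qed.

End LowerCentral.

(** * The powers of a pro-nilpotent operator *)

(** The images of the powers of T form the filtration to be refined. *)
Lemma pro_nilpotent_op_strict (K : fieldType) (V : lmodType K)
    (T : {linear V -> V}) :
  infinite_dim V -> pro_nilpotent_op T -> strictly_triangularizable T.
Proof.
move=> Vinf [capT finT]; pose G k := range (iter k T).
have Gsub k : linear_subspace (G k).
  have iter_lin n c u v : iter n T (c *: u + v) = c *: iter n T u + iter n T v.
    by elim: n => //= n ->; rewrite linearP.
  apply/linear_subspaceP; split.
    by exists 0 => //; elim: k => //= k ->; rewrite linear0.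
  by move=> c _ _ [u _ <-] [v _ <-]; exists (c *: u + v).
have TG k : T @` G k `<=` G k.+1 by move=> _ [_ [u _ <-] <-]; exists u.
have GS k : G k.+1 `<=` G k by move=> _ [u _ <-]; exists (T u); rewrite ?iterSr.
have [|//|//|k||F Ffull Fk] := @refining_chain K V G Vinf.
- by apply/seteqP; split=> // v _; exists v.
- exact: quot_fin_dim_span_over (Gsub k.+1) (finT k).
- apply/seteqP; split=> [v Gv|_ -> k _]; last exact: subspace0.
  by rewrite -capT => k _; apply: Gv.
have [_ _ Fdecr _ _] := Ffull.
have TF i : T @` F i `<=` F i.+1.
  have [k FG GF] := Fk i; apply: subset_trans GF.
  by apply: subset_trans (@TG k); apply: image_subset.
exists F => //; split=> // i.
exact: subset_trans (TF i) (Fdecr i).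
Qed.

Theorem proposition2p5 (R : realType) (L : lieAlgebraType R[i]%C)
    (hbasis : has_countable_basis L) (hinf : infinite_dim L) :
  (pro_nilpotent_lie L -> ad_strictly_triangularizable L) /\
  (forall x : L,
     pro_nilpotent_op (ad x) -> strictly_triangularizable (ad x)).
Proof.
split=> [|x]; first exact: pro_nilpotent_lie_ad.
exact: pro_nilpotent_op_strict.
Qed.
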